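(* Let $k\ge 1$, let $d=\binom{k+1}{2}$, and let $M\in\mathbb{R}^{p\times q}$ be an entrywise nonnegative matrix of rank $d$. Let $M=UV$ be a rank factorization, with $U\in\mathbb{R}^{p\times d}$ and $V\in\mathbb{R}^{d\times q}$, let $u_1,\dots,u_p\in\mathbb{R}^d$ be the rows of $U$ and $v_1,\dots,v_q\in\mathbb{R}^d$ the columns of $V$. Then $M$ has psd rank $k$ if and only if there are two matrices $L,K\in\mathbb{R}^{d\times d}$ such that (1) $L$ is the inverse of $K$, i.e. $LK=KL=I$; (2) the $k\times k$ linear matrix inequality $Ku_i\succeq 0$ holds for each row $u_i$ of $U$; (3) the $k\times k$ linear matrix inequality $v_j^TL\succeq 0$ holds for each column $v_j$ of $V$. Further, this system can be written down in polynomial time from $M$.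
   Context: Let $\mathcal{S}^k$ be the space of real symmetric $k\times k$ matrices and $\mathcal{S}_+^k$ the cone of positive semidefinite matrices in it. The psd rank of a nonnegative $p\times q$ matrix $M$ is the smallest $k$ such that there are $A_1,\dots,A_p,B_1,\dots,B_q\in\mathcal{S}_+^k$ with $M_{ij}=\mathrm{Trace}(A_iB_j)$ for all $i,j$. Identification of $\mathbb{R}^d$ with $\mathcal{S}^k$, $d=\binom{k+1}{2}$: let $E_{ii}$ be the $k\times k$ matrix with a one in position $(i,i)$ and zeros elsewhere, and for $i<j$ let $E_{ij}$ be the matrix with $\frac{1}{\sqrt2}$ in positions $(i,j)$ and $(j,i)$ and zeros elsewhere. A vector $y=(y_{ij})_{1\le i\le j\le k}\in\mathbb{R}^d$ is identified with the symmetric matrix $Y=\sum_{1\le i\le j\le k}y_{ij}E_{ij}$; this preserves inner products. For a vector $y\in\mathbb{R}^d$ (row or column), $y\succeq0$ means that the corresponding symmetric $k\times k$ matrix $Y$ is positive semidefinite. Computations are in a real-number model in which arithmetic operations and comparisons on real numbers have unit cost. *)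

(* Defs.v *)
From Stdlib Require List.
From HB Require Import structures.
From mathcomp Require Import all_boot all_order all_algebra.
From mathcomp Require Import reals.

Set Implicit Arguments.
Unset Strict Implicit.
Unset Printing Implicit Defensive.

Import Order.TTheory GRing.Theory Num.Theory.

Local Open Scope ring_scope.

Definition psd (R : realType) (k : nat) (A : 'M[R]_k) : Prop :=
  A^T = A /\ forall x : 'cV[R]_k, 0 <= (x^T *m A *m x) 0 0.

Definition nonneg_mx (R : realType) (p q : nat) (M : 'M[R]_(p, q)) : Prop :=
  forall i j, 0 <= M i j.

Definition has_psd_factorization (R : realType) (p q : nat)
    (M : 'M[R]_(p, q)) (k : nat) : Prop :=
  exists (A : 'I_p -> 'M[R]_k) (B : 'I_q -> 'M[R]_k),
    [/\ forall i, psd (A i), forall j, psd (B j)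
      & forall i j, M i j = \tr (A i *m B j)].

Definition is_psd_rank (R : realType) (p q : nat)
    (M : 'M[R]_(p, q)) (k : nat) : Prop :=
  has_psd_factorization M k /\
  forall m : nat, has_psd_factorization M m -> (k <= m)%N.

(* The coordinates y_ij, i <= j, are laid out column by column of the upper
   triangle: (0,0), (0,1), (1,1), (0,2), (1,2), (2,2), and so on.  Changing
   this order only conjugates L and K by a permutation matrix. *)
Lemma sym_idx_subproof (k : nat) (i j : 'I_k) :
  ('C((maxn i j).+1, 2) + minn i j < 'C(k.+1, 2))%N.
Proof.
have lt_max : (maxn i j < k)%N by rewrite gtn_max !ltn_ord.
apply: (@leq_trans 'C((maxn i j).+2, 2)).
  rewrite [X in (_ < X)%N]binS bin1 ltn_add2l ltnS.
  by rewrite geq_min leq_maxl.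
by rewrite leq_bin2l.
Qed.

Definition sym_idx (k : nat) (i j : 'I_k) : 'I_('C(k.+1, 2)) :=
  Ordinal (sym_idx_subproof i j).

Definition sym_unit (R : realType) (k : nat) (i j : 'I_k) : 'M[R]_k :=
  if i == j then delta_mx i i
  else (Num.sqrt 2)^-1 *: (delta_mx i j + delta_mx j i).

Definition sym_of_vec (R : realType) (k : nat) (y : 'rV[R]_('C(k.+1, 2))) :
    'M[R]_k :=
  \sum_(i < k) \sum_(j < k | (i <= j)%N) y 0 (sym_idx i j) *: sym_unit R i j.

Definition vec_psd (R : realType) (k : nat) (y : 'rV[R]_('C(k.+1, 2))) : Prop :=
  psd (sym_of_vec y).

(* The row u_i of U is used as the column vector (row i U)^T, the column v_j of
   V as the row vector (col j V)^T. *)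
Definition psd_conditions (R : realType) (k p q : nat)
    (U : 'M[R]_(p, 'C(k.+1, 2))) (V : 'M[R]_('C(k.+1, 2), q))
    (L K : 'M[R]_('C(k.+1, 2))) : Prop :=
  [/\ L *m K = 1%:M /\ K *m L = 1%:M,
      forall i : 'I_p, vec_psd (K *m (row i U)^T)^T
    & forall j : 'I_q, vec_psd ((col j V)^T *m L)].

(* The equation  \sum_((c, v, w)) c * x_v * x_w = rhs. *)
Record quad_eq (R : realType) := QuadEq {
  qe_terms : seq (R * nat * nat);
  qe_rhs : R }.

(* The inequality  \sum_((v, A)) x_v *: A  psd. *)
Record lmi (R : realType) (k : nat) := Lmi {
  lmi_terms : seq (nat * 'M[R]_k) }.

Record psd_system (R : realType) (k : nat) := PsdSystem {
  sys_nvars : nat;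
  sys_eqs : seq (quad_eq R);
  sys_lmis : seq (lmi R k) }.

Definition quad_eq_holds (R : realType) (x : nat -> R) (e : quad_eq R) : Prop :=
  \sum_(t <- qe_terms e) t.1.1 * x t.1.2 * x t.2 = qe_rhs e.

Definition lmi_holds (R : realType) (k : nat) (x : nat -> R) (l : lmi R k) :
    Prop :=
  psd (\sum_(t <- lmi_terms l) x t.1 *: t.2).

Definition system_holds (R : realType) (k : nat) (x : nat -> R)
    (S : psd_system R k) : Prop :=
  List.Forall (quad_eq_holds x) (sys_eqs S) /\
  List.Forall (lmi_holds x) (sys_lmis S).

(* The unknowns are the entries of L, row by row, then those of K. *)
Definition Lvar (d : nat) (a b : 'I_d) : nat := (a * d + b)%N.
Definition Kvar (d : nat) (a b : 'I_d) : nat := (d * d + (a * d + b))%N.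

Definition inverse_eqs (R : realType) (d : nat)
    (X Y : 'I_d -> 'I_d -> nat) : seq (quad_eq R) :=
  [seq QuadEq [seq (1, X i m, Y m j) | m <- enum 'I_d] (i == j)%:R
     | i <- enum 'I_d, j <- enum 'I_d].

(* (K u)_a = \sum_b K_ab u_b, where u is the i-th row of U. *)
Definition row_lmi (R : realType) (k p : nat)
    (U : 'M[R]_(p, 'C(k.+1, 2))) (i : 'I_p) : lmi R k :=
  Lmi [seq (Kvar a b, U i b *: sym_of_vec (delta_mx 0 a))
         | a <- enum 'I_('C(k.+1, 2)), b <- enum 'I_('C(k.+1, 2))].

(* (v^T L)_b = \sum_a v_a L_ab, where v is the j-th column of V. *)
Definition col_lmi (R : realType) (k q : nat)
    (V : 'M[R]_('C(k.+1, 2), q)) (j : 'I_q) : lmi R k :=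
  Lmi [seq (Lvar a b, V a j *: sym_of_vec (delta_mx 0 b))
         | a <- enum 'I_('C(k.+1, 2)), b <- enum 'I_('C(k.+1, 2))].

Definition psd_system_of (R : realType) (k p q : nat)
    (U : 'M[R]_(p, 'C(k.+1, 2))) (V : 'M[R]_('C(k.+1, 2), q)) :
    psd_system R k :=
  let d := 'C(k.+1, 2) in
  PsdSystem (2 * (d * d))
    (inverse_eqs R (@Lvar d) (@Kvar d) ++ inverse_eqs R (@Kvar d) (@Lvar d))
    ([seq row_lmi U i | i <- enum 'I_p] ++ [seq col_lmi V j | j <- enum 'I_q]).

Definition mx_word (R : realType) (m n : nat) (A : 'M[R]_(m, n)) : seq R :=
  [seq A i j | i <- enum 'I_m, j <- enum 'I_n].

Definition quad_eq_word (R : realType) (e : quad_eq R) : seq R :=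
  (size (qe_terms e))%:R
    :: flatten [seq [:: t.1.1; t.1.2%:R; t.2%:R] | t <- qe_terms e]
    ++ [:: qe_rhs e].

Definition lmi_word (R : realType) (k : nat) (l : lmi R k) : seq R :=
  (size (lmi_terms l))%:R
    :: flatten [seq t.1%:R :: mx_word t.2 | t <- lmi_terms l].

Definition system_word (R : realType) (k : nat) (S : psd_system R k) : seq R :=
  [:: (sys_nvars S)%:R; k%:R; (size (sys_eqs S))%:R; (size (sys_lmis S))%:R]
    ++ flatten [seq quad_eq_word e | e <- sys_eqs S]
    ++ flatten [seq lmi_word l | l <- sys_lmis S].

(* Structured programs over natural-number registers (used for loop counters
   and addresses), finitely many real arrays, and a write-only output tape.
   Real numbers can only be combined by field operations and compared: there
   is no rounding and no conversion from reals to naturals.  Every arithmetic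
   operation, comparison and memory access costs one step.  As in the
   Blum-Shub-Smale model, a program may mention finitely many real constants,
   such as 1 / sqrt 2. *)

Inductive nexp : Type :=
| NConst of nat
| NReg of nat
| NAdd of nexp & nexp
| NSub of nexp & nexp
| NMul of nexp & nexp.

Inductive rexp (R : realType) : Type :=
| RConst of R
| RNat of nexp
| RCell of nat & nexp
| RAdd of rexp R & rexp R
| RSub of rexp R & rexp R
| RMul of rexp R & rexp R
| RDiv of rexp R & rexp R.

Inductive test (R : realType) : Type :=
| TNatLe of nexp & nexp
| TRealLe of rexp R & rexp R
| TNot of test R.

Inductive cmd (R : realType) : Type :=
| CSetReg of nat & nexp
| CSetCell of nat & nexp & rexp R
| COutput of rexp R
| CSeq of cmd R & cmd R
| CIf of test R & cmd R & cmd R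
| CWhile of test R & cmd R.

Record state (R : realType) := State {
  st_reg : nat -> nat;
  st_cell : nat -> nat -> R;
  st_out : seq R }.

Fixpoint neval (R : realType) (s : state R) (e : nexp) : nat :=
  match e with
  | NConst n => n
  | NReg x => st_reg s x
  | NAdd e1 e2 => neval s e1 + neval s e2
  | NSub e1 e2 => neval s e1 - neval s e2
  | NMul e1 e2 => neval s e1 * neval s e2
  end%N.

(* Division by zero yields zero, which a program could arrange by a test. *)
Fixpoint reval (R : realType) (s : state R) (e : rexp R) : R :=
  match e with
  | RConst c => c
  | RNat e1 => (neval s e1)%:R
  | RCell a e1 => st_cell s a (neval s e1)
  | RAdd e1 e2 => reval s e1 + reval s e2
  | RSub e1 e2 => reval s e1 - reval s e2
  | RMul e1 e2 => reval s e1 * reval s e2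
  | RDiv e1 e2 => reval s e1 / reval s e2
  end.

Fixpoint teval (R : realType) (s : state R) (b : test R) : bool :=
  match b with
  | TNatLe e1 e2 => (neval s e1 <= neval s e2)%N
  | TRealLe e1 e2 => reval s e1 <= reval s e2
  | TNot b1 => ~~ teval s b1
  end.

Fixpoint ncost (e : nexp) : nat :=
  match e with
  | NConst _ | NReg _ => 1
  | NAdd e1 e2 | NSub e1 e2 | NMul e1 e2 => (ncost e1 + ncost e2).+1
  end%N.

Fixpoint rcost (R : realType) (e : rexp R) : nat :=
  match e with
  | RConst _ => 1
  | RNat e1 | RCell _ e1 => (ncost e1).+1
  | RAdd e1 e2 | RSub e1 e2 | RMul e1 e2 | RDiv e1 e2 =>
      (rcost e1 + rcost e2).+1
  end%N.

Fixpoint tcost (R : realType) (b : test R) : nat :=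
  match b with
  | TNatLe e1 e2 => (ncost e1 + ncost e2).+1
  | TRealLe e1 e2 => (rcost e1 + rcost e2).+1
  | TNot b1 => (tcost b1).+1
  end%N.

Definition set_reg (R : realType) (s : state R) (x n : nat) : state R :=
  State (fun y => if y == x then n else st_reg s y) (st_cell s) (st_out s).

Definition set_cell (R : realType) (s : state R) (a i : nat) (v : R) :
    state R :=
  State (st_reg s)
    (fun b j => if (b == a) && (j == i) then v else st_cell s b j) (st_out s).

Definition add_out (R : realType) (s : state R) (v : R) : state R :=
  State (st_reg s) (st_cell s) (rcons (st_out s) v).

(* [exec c s t s']: run from s, the program c halts in s' after t steps. *)
Inductive exec (R : realType) : cmd R -> state R -> nat -> state R -> Prop :=
| ExecSetReg x e s :
    exec (CSetReg R x e) s (ncost e).+1 (set_reg s x (neval s e))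
| ExecSetCell a e r s :
    exec (CSetCell a e r) s (ncost e + rcost r).+1
      (set_cell s a (neval s e) (reval s r))
| ExecOutput r s :
    exec (COutput r) s (rcost r).+1 (add_out s (reval s r))
| ExecSeq c1 c2 s s1 s2 t1 t2 :
    exec c1 s t1 s1 -> exec c2 s1 t2 s2 ->
    exec (CSeq c1 c2) s (t1 + t2)%N s2
| ExecIf b c1 c2 s s1 t :
    exec (if teval s b then c1 else c2) s t s1 ->
    exec (CIf b c1 c2) s (tcost b + t).+1 s1
| ExecWhileEnd b c s :
    ~~ teval s b -> exec (CWhile b c) s (tcost b).+1 s
| ExecWhileStep b c s s1 s2 t1 t2 :
    teval s b -> exec c s t1 s1 -> exec (CWhile b c) s1 t2 s2 ->
    exec (CWhile b c) s (tcost b + t1 + t2).+1 s2.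

(* Registers 0 and 1 hold the numbers of rows and columns, array 0 the entries
   row by row; everything else is zero. *)
Definition input_state (R : realType) (p q : nat) (M : 'M[R]_(p, q)) :
    state R :=
  State (nth 0%N [:: p; q])
    (fun a => nth 0 (if a == 0%N then mx_word M else [::])) [::].

Lemma sym_of_vec_sum (R : realType) (k n : nat) (c : 'I_n -> R)
    (y : 'I_n -> 'rV[R]_('C(k.+1, 2))) :
  sym_of_vec (\sum_a c a *: y a) = \sum_a c a *: sym_of_vec (y a).
Proof.
rewrite /sym_of_vec; under [RHS]eq_bigr => a _ do rewrite scaler_sumr.
rewrite exchange_big; apply: eq_bigr => i _ /=.
under [RHS]eq_bigr => a _ do rewrite scaler_sumr.
rewrite exchange_big; apply: eq_bigr => j _ /=.
rewrite summxE scaler_suml; apply: eq_bigr => a _.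
by rewrite mxE scalerA.
Qed.

Lemma sym_of_vec_delta (R : realType) (k : nat) (y : 'rV[R]_('C(k.+1, 2))) :
  sym_of_vec y = \sum_a y 0 a *: sym_of_vec (delta_mx 0 a).
Proof. by rewrite {1}(row_sum_delta y) sym_of_vec_sum. Qed.

Lemma Forall_map_enum (n : nat) (T : Type) (P : T -> Prop) (f : 'I_n -> T) :
  List.Forall P [seq f i | i <- enum 'I_n] <-> forall i, P (f i).
Proof.
suff: List.Forall P [seq f i | i <- enum 'I_n] <->
      forall i, i \in enum 'I_n -> P (f i).
  by move=> ->; split=> H i; [apply: H; rewrite mem_enum | move=> _].
elim: (enum 'I_n) => [|i s IHs] /=; first by split.
rewrite List.Forall_cons_iff IHs; split=> [[Pi Ps] j|Ps].
  by rewrite inE => /predU1P[->|/Ps].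
by split=> [|j js]; apply: Ps; rewrite inE ?eqxx // js orbT.
Qed.

Lemma Forall_allpairs_enum (n : nat) (T : Type) (P : T -> Prop)
    (f : 'I_n -> 'I_n -> T) :
  List.Forall P [seq f i j | i <- enum 'I_n, j <- enum 'I_n] <->
  forall i j, P (f i j).
Proof.
suff: List.Forall P [seq f i j | i <- enum 'I_n, j <- enum 'I_n] <->
      forall i, i \in enum 'I_n -> forall j, P (f i j).
  by move=> ->; split=> H i; [apply: H; rewrite mem_enum | move=> _].
elim: {2 3}(enum _) => [|i s IHs] /=; first by split.
rewrite List.Forall_app IHs Forall_map_enum; split=> [[Pi Ps] j|Ps].
  by rewrite inE => /predU1P[->|/Ps].
by split=> [|j js]; apply: Ps; rewrite inE ?eqxx // js orbT.
Qed.

Lemma inverse_eqsP (R : realType) (d : nat) (x : nat -> R)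
    (X Y : 'I_d -> 'I_d -> nat) (A B : 'M[R]_d) :
  (forall i j, x (X i j) = A i j) -> (forall i j, x (Y i j) = B i j) ->
  List.Forall (quad_eq_holds x) (inverse_eqs R X Y) <-> A *m B = 1%:M.
Proof.
move=> xA xB; rewrite Forall_allpairs_enum.
have eP i j : \sum_(m < d) x (X i m) * x (Y m j) = (A *m B) i j.
  by rewrite mxE; apply: eq_bigr => m _; rewrite xA xB.
have sumE i j : \sum_(t <- [seq (1 : R, X i m, Y m j) | m <- enum 'I_d])
    t.1.1 * x t.1.2 * x t.2 = (A *m B) i j.
  by rewrite big_map big_enum -eP; apply: eq_bigr => m _ /=; rewrite mul1r.
split=> [sol|AB i j]; last by rewrite /quad_eq_holds sumE AB mxE.
by apply/matrixP => i j; rewrite -sumE (sol i j) mxE.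
Qed.

Lemma row_lmiP (R : realType) (k p : nat) (x : nat -> R)
    (U : 'M[R]_(p, 'C(k.+1, 2))) (K : 'M[R]_('C(k.+1, 2))) (i : 'I_p) :
  (forall a b, x (Kvar a b) = K a b) ->
  lmi_holds x (row_lmi U i) <-> vec_psd (K *m (row i U)^T)^T.
Proof.
move=> xK; rewrite /lmi_holds /vec_psd big_allpairs_dep /= big_enum /=.
rewrite sym_of_vec_delta; under eq_bigr => a _ do rewrite big_enum /=.
set A := (X in psd X <-> _); set B := (X in _ <-> psd X).
suff -> : A = B by [].
apply: eq_bigr => a _; rewrite !mxE scaler_suml; apply: eq_bigr => b _.
by rewrite !mxE scalerA xK.
Qed.

Lemma col_lmiP (R : realType) (k q : nat) (x : nat -> R)
    (V : 'M[R]_('C(k.+1, 2), q)) (L : 'M[R]_('C(k.+1, 2))) (j : 'I_q) :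
  (forall a b, x (Lvar a b) = L a b) ->
  lmi_holds x (col_lmi V j) <-> vec_psd ((col j V)^T *m L).
Proof.
move=> xL; rewrite /lmi_holds /vec_psd big_allpairs_dep /= big_enum /=.
rewrite sym_of_vec_delta; under eq_bigr => a _ do rewrite big_enum /=.
rewrite exchange_big /=.
set A := (X in psd X <-> _); set B := (X in _ <-> psd X).
suff -> : A = B by [].
apply: eq_bigr => b _; rewrite !mxE scaler_suml; apply: eq_bigr => a _.
by rewrite !mxE scalerA xL mulrC.
Qed.

Lemma psd_system_ofP (R : realType) (k p q : nat) (x : nat -> R)
    (U : 'M[R]_(p, 'C(k.+1, 2))) (V : 'M[R]_('C(k.+1, 2), q))
    (L K : 'M[R]_('C(k.+1, 2))) :
  (forall a b, x (Lvar a b) = L a b) -> (forall a b, x (Kvar a b) = K a b) ->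
  system_holds x (psd_system_of U V) <-> psd_conditions U V L K.
Proof.
move=> xL xK; rewrite /system_holds /= !List.Forall_app !Forall_map_enum.
rewrite (inverse_eqsP xL xK) (inverse_eqsP xK xL) /psd_conditions.
split=> [[LK [rowP colP]]|[LK rowP colP]].
  by split=> // [i|j]; [apply/(row_lmiP _ _ xK) | apply/(col_lmiP _ _ xL)].
by split=> //; split=> [i|j]; [apply/(row_lmiP _ _ xK) | apply/(col_lmiP _ _ xL)].
Qed.

(* Main.v *)
Require Import Defs.
From HB Require Import structures.
From mathcomp Require Import all_boot all_order all_algebra.
From mathcomp Require Import reals boolp.
From mathcomp Require Import zify ring lra.

(* With respect to the basis E_ij the trace form on symmetric matrices is the
   standard inner product, so a psd factorization of size k is a factorization
   of M through R^d, d = k(k+1)/2, whose rows and columns are psd.  Two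
   factorizations of M through R^d, d = rank M, differ by an invertible d x d
   matrix, which gives K and its inverse L; a smaller psd factorization would
   make the rank smaller than d.

   For the complexity claim, U and V come from Wedderburn's rank reduction: scan
   the entries of M in reading order and, whenever the current entry w_ij is
   nonzero, subtract (column j)(row i) / w_ij, which clears row i and column j
   and lowers the rank by exactly one.  Then k is found by search and the system
   is printed by nested loops.  All loops make at most p q turns, so the running
   time is at most a constant times (p q)^e, with e the nesting depth of the
   loops. *)

Set Implicit Arguments.
Unset Strict Implicit.
Unset Printing Implicit Defensive.

Import Order.TTheory GRing.Theory Num.Theory.

Local Open Scope ring_scope.

(** * Symmetric matrices and their coordinates *)

Lemma double_binS2 (k : nat) : ('C(k.+1, 2) * 2 = k * k.+1)%N.
Proof. by have := mul_bin_diag k.+1 1; rewrite bin1 /=; lia. Qed.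

(** Column [m] of the upper triangle occupies the addresses from ['C(m.+1, 2)] to ['C(m.+1, 2) + m],
    so an address in it precedes the start of every later column. *)
Lemma leq_of_binS2 (m m' n n' : nat) :
  (n <= m)%N -> ('C(m.+1, 2) + n = 'C(m'.+1, 2) + n')%N -> (m' <= m)%N.
Proof.
have e := double_binS2 m; have e' := double_binS2 m'.
move=> le_nm eq_mm'; rewrite leqNgt; apply/negP => lt_mm'.
by have : (m.+1 * m.+2 <= m' * m'.+1)%N; [apply: leq_mul; lia | lia].
Qed.

Lemma sym_idxC (k : nat) (i j : 'I_k) : sym_idx i j = sym_idx j i.
Proof. by apply: val_inj; rewrite /= maxnC minnC. Qed.

(** The column of the triangle that contains the address gives the maximum and the offset in it the
    minimum; only the order of the pair is lost. *)
Lemma sym_idx_inj (k : nat) (i j i' j' : 'I_k) :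
  sym_idx i j = sym_idx i' j' -> (i, j) = (i', j') \/ (i, j) = (j', i').
Proof.
move=> /(congr1 val) /= e.
have [eqm eqn] : maxn i j = maxn i' j' /\ minn i j = minn i' j'.
  have eqm : maxn i j = maxn i' j'.
    apply/eqP; rewrite eqn_leq; apply/andP; split.
      by apply: leq_of_binS2 (esym e); lia.
    by apply: leq_of_binS2 e; lia.
  by split=> //; move: e; rewrite eqm; lia.
have : (i = i' :> nat /\ j = j' :> nat) \/
       (i = j' :> nat /\ j = i' :> nat) by lia.
by case=> -[/val_inj -> /val_inj ->]; [left | right].
Qed.

(** Passing from [k] to [k.+1] adds one column, with the addresses from ['C(k.+1, 2)] on. The
    boolean equality is the form that [xchoose] needs. *)
Lemma sym_idx_surj (k : nat) (a : 'I_('C(k.+1, 2))) :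
  exists ij : 'I_k * 'I_k, sym_idx ij.1 ij.2 == a.
Proof.
suff H n : (n < 'C(k.+1, 2))%N ->
    exists i j : 'I_k, 'C((maxn i j).+1, 2) + minn i j = n.
  have [i [j e]] := H a (ltn_ord a).
  by exists (i, j); apply/eqP/val_inj.
elim: k {a} => [|k IHk] //.
have [lt_n _|le_n lt_n] := ltnP n 'C(k.+1, 2).
  have [i [j e]] := IHk lt_n.
  by exists (widen_ord (leqnSn k) i), (widen_ord (leqnSn k) j).
have lt_d : (n - 'C(k.+1, 2) < k.+1)%N by move: lt_n; rewrite binS bin1; lia.
exists (Ordinal lt_d), ord_max => /=.
by rewrite (maxn_idPr _) ?(minn_idPl _) //; lia.
Qed.

Definition sym_pair (k : nat) (a : 'I_('C(k.+1, 2))) : 'I_k * 'I_k :=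
  xchoose (sym_idx_surj a).

Lemma sym_pairK (k : nat) (a : 'I_('C(k.+1, 2))) :
  sym_idx (sym_pair a).1 (sym_pair a).2 = a.
Proof. exact/eqP/(xchooseP (sym_idx_surj a)). Qed.

Definition sym_scale (R : realType) (k : nat) (i j : 'I_k) : R :=
  if i == j then 1 else (Num.sqrt 2)^-1.

Lemma sym_scaleC (R : realType) (k : nat) (i j : 'I_k) :
  sym_scale R i j = sym_scale R j i.
Proof. by rewrite /sym_scale eq_sym. Qed.

Lemma sym_scale_neq0 (R : realType) (k : nat) (i j : 'I_k) :
  sym_scale R i j != 0.
Proof.
rewrite /sym_scale; case: (i == j); rewrite ?oner_eq0 //.
by rewrite invr_eq0 sqrtr_eq0 -ltNge.
Qed.

Lemma sym_of_vecE (R : realType) (k : nat) (y : 'rV[R]_('C(k.+1, 2)))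
    (i j : 'I_k) :
  sym_of_vec y i j = y 0 (sym_idx i j) * sym_scale R i j.
Proof.
wlog le_ij : i j / (i <= j)%N => [wl|].
  have /orP[/wl //|/wl e] := leq_total i j.
  rewrite sym_idxC sym_scaleC -e /sym_of_vec !summxE.
  apply: eq_bigr => x _; rewrite !summxE; apply: eq_bigr => z _.
  rewrite /sym_unit !mxE; case: eqP => [_|_]; rewrite !mxE 1?[RHS]addrC.
    by rewrite andbC.
  by rewrite addrC; congr (_ * (_ * (_ + _))); rewrite andbC.
rewrite /sym_of_vec summxE (bigD1 i) //= summxE (bigD1 j) //= !mxE.
rewrite [X in _ + X + _]big1 => [|z /andP[le_iz nzj]]; last first.
  rewrite !mxE /sym_unit; have [eiz|niz] := eqVneq i z.
    by rewrite !mxE eqxx /= eiz eq_sym (negPf nzj) mulr0.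
  rewrite !mxE eqxx /= eq_sym (negPf nzj) (negPf niz) /= addr0 !mulr0 //.
rewrite big1 => [|x nxi]; last first.
  rewrite summxE big1 // => z le_xz.
  rewrite !mxE /sym_unit; have [exz|nxz] := eqVneq x z.
    by rewrite !mxE eq_sym (negPf nxi) /= mulr0.
  rewrite !mxE eq_sym (negPf nxi) /= add0r.
  (* The second entry of [E_xz], at [(z, x)], meets [(i, j)] only if [j = x <= z = i]; with [i <= j]
     this forces [x = z]. *)
  case: eqP => [eiz|_] /=; last by rewrite !mulr0.
  case: eqP => [ejx|_] /=; last by rewrite !mulr0.
  by case/eqP: nxz; apply/val_inj; move: le_ij; rewrite eiz ejx /=; lia.
rewrite !addr0 /sym_unit /sym_scale; have [->|nij] := eqVneq i j.
  by rewrite !mxE eqxx /=.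
by rewrite !mxE !eqxx (negPf nij) /= addr0 mulr1.
Qed.

Definition vec_of_sym (R : realType) (k : nat) (A : 'M[R]_k) :
    'rV[R]_('C(k.+1, 2)) :=
  \row_a (A (sym_pair a).1 (sym_pair a).2 /
          sym_scale R (sym_pair a).1 (sym_pair a).2).

Lemma vec_of_symK (R : realType) (k : nat) (A : 'M[R]_k) :
  A^T = A -> sym_of_vec (vec_of_sym A) = A.
Proof.
move=> symA; apply/matrixP => i j; rewrite sym_of_vecE mxE.
have := sym_idx_inj (sym_pairK (sym_idx i j)); case: (sym_pair _) => x y /=.
case=> -[-> ->]; rewrite ?(sym_scaleC R j) divfK ?sym_scale_neq0 //.
by rewrite -[in LHS]symA mxE.
Qed.

(** The matrices [E_ij] have norm one: an off-diagonal coordinate sits at two positions of squared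
    weight 1/2, a diagonal one at a single position of weight 1. *)
Lemma sum_sym_scale (R : realType) (k : nat) (a : 'I_('C(k.+1, 2))) :
  \sum_(ij : 'I_k * 'I_k | sym_idx ij.1 ij.2 == a)
    sym_scale R ij.1 ij.2 ^+ 2 = 1.
Proof.
case: (sym_pair a) (sym_pairK a) => i j /= <- {a}.
rewrite (bigD1 (i, j)) //=; have [->|nij] := eqVneq i j.
  rewrite big1 => [|[x y] /= /andP[/eqP/sym_idx_inj []-> /[!eqxx]]] //.
  by rewrite /sym_scale eqxx expr1n addr0.
rewrite (bigD1 (j, i)) /=; last first.
  by rewrite (sym_idxC j i) eqxx xpair_eqE negb_and nij orbT.
rewrite big1 => [|[x y] /= /andP[/andP[/eqP/sym_idx_inj []-> /[!eqxx]]]] //.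
rewrite /sym_scale [j == i]eq_sym (negPf nij) addr0 exprVn sqr_sqrtr //; lra.
Qed.

(** Group the positions [(i, j)] by their coordinate [a]: each group contributes [y_a * z_a] times
    its total squared weight, which is 1. *)
Lemma trace_sym_of_vec (R : realType) (k : nat)
    (y z : 'rV[R]_('C(k.+1, 2))) :
  \tr (sym_of_vec y *m sym_of_vec z) = (y *m z^T) 0 0.
Proof.
rewrite /mxtrace; under eq_bigr => i _ do rewrite mxE.
rewrite pair_bigA /=.
rewrite (partition_big (fun ij => sym_idx ij.1 ij.2) xpredT) //= mxE.
apply: eq_bigr => a _; rewrite !mxE -[RHS]mulr1 -(sum_sym_scale R a).
rewrite big_distrr /=; apply: eq_bigr => -[i j] /= /eqP <-.
by rewrite !sym_of_vecE (sym_idxC j) (sym_scaleC R j); ring.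
Qed.

(** * Psd factorizations as rank factorizations *)

Lemma psd_factorization_vec (R : realType) (p q m : nat) (M : 'M[R]_(p, q)) :
  has_psd_factorization M m ->
  exists (A : 'M[R]_(p, 'C(m.+1, 2))) (B : 'M[R]_('C(m.+1, 2), q)),
    [/\ M = A *m B, forall i, vec_psd (row i A)
      & forall j, vec_psd (col j B)^T].
Proof.
case=> A [B [psdA psdB trM]].
exists (\matrix_i vec_of_sym (A i)), (\matrix_j vec_of_sym (B j))^T.
split=> [|i|j]; last 2 first.
- by rewrite rowK /vec_psd vec_of_symK //; case: (psdA i).
- by rewrite -tr_row trmxK rowK /vec_psd vec_of_symK //; case: (psdB j).
apply/matrixP => i j; rewrite trM.
rewrite -{1}[A i]vec_of_symK -1?{1}[B j]vec_of_symK; last 2 first.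
- by case: (psdB j).
- by case: (psdA i).
by rewrite trace_sym_of_vec !mxE; apply: eq_bigr => a _; rewrite !mxE.
Qed.

(** As [A *m B] has rank [d], [A] has a left inverse and [B] a right inverse. Applying one of them
    to [U *m V = A *m B] yields [K] or [L]; applying both yields [L *m K = 1%:M]. *)
Lemma rank_factorization_uniq (F : fieldType) (p q d : nat)
    (U A : 'M[F]_(p, d)) (V B : 'M[F]_(d, q)) :
  \rank (U *m V) = d -> U *m V = A *m B ->
  exists K L : 'M[F]_d, [/\ A = U *m K, B = L *m V & K *m L = 1%:M].
Proof.
move=> rUV eqM.
have rAB : \rank (A *m B) = d by rewrite -eqM.
have fullP (X : 'M[F]_(p, d)) Y : \rank (X *m Y) = d -> row_full X.
  move=> r; rewrite /row_full eqn_leq rank_leq_col -{1}r.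
  by rewrite mxrankM_maxl.
have freeP (X : 'M[F]_(p, d)) (Y : 'M[F]_(d, q)) :
    \rank (X *m Y) = d -> row_free Y.
  move=> r; rewrite /row_free eqn_leq rank_leq_row -{1}r.
  by rewrite mxrankM_maxr.
have AK : pinvmx A *m A = 1%:M by apply: mulVpmx; apply: fullP rAB.
have BK : B *m pinvmx B = 1%:M by apply: mulmxVp; apply: freeP rAB.
exists (V *m pinvmx B), (pinvmx A *m U); split.
- by rewrite mulmxA eqM -mulmxA BK mulmx1.
- by rewrite -mulmxA eqM mulmxA AK mul1mx.
apply: mulmx1C.
by rewrite mulmxA -(mulmxA _ U) eqM mulmxA AK mul1mx BK.
Qed.

Lemma psd_rank_conditions (R : realType) (k p q : nat) (M : 'M[R]_(p, q))
    (U : 'M[R]_(p, 'C(k.+1, 2))) (V : 'M[R]_('C(k.+1, 2), q)) :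
  (1 <= k)%N -> \rank M = 'C(k.+1, 2) -> M = U *m V ->
  is_psd_rank M k <-> exists L K, psd_conditions U V L K.
Proof.
move=> k_gt0 rM eM; split.
  case=> /psd_factorization_vec [A [B [eAB psdA psdB]]] _.
  have [||K [L [eA eB KL]]] := @rank_factorization_uniq _ _ _ _ U A V B.
  - by rewrite -eM.
  - by rewrite -eM.
  (* The conditions apply [K] to columns and [L] to rows, whereas [A = U *m K] and [B = L *m V]
     multiply on the other sides; hence the transposes. *)
  exists L^T, K^T; split=> [|i|j].
  - by rewrite -!trmx_mul KL (mulmx1C KL) trmx1.
  - by rewrite trmx_mul !trmxK -row_mul -eA.
  - by rewrite -trmx_mul !colE mulmxA -eB -colE.
case=> L [K [[LK KL] psdK psdL]]; split.
  exists (fun i => sym_of_vec (K *m (row i U)^T)^T),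
    (fun j => sym_of_vec ((col j V)^T *m L)).
  split=> // i j; rewrite trace_sym_of_vec.
  rewrite !trmx_mul !trmxK mulmxA -(mulmxA _ K^T) -trmx_mul LK trmx1 mulmx1.
  by rewrite eM !mxE; apply: eq_bigr => a _; rewrite !mxE.
(* Minimality: a psd factorization of size [m] passes through dimension ['C(m.+1, 2)], which
   therefore bounds the rank of [M]. *)
move=> m /psd_factorization_vec [A [B [eAB _ _]]].
have le_d : ('C(k.+1, 2) <= 'C(m.+1, 2))%N.
  by rewrite -rM eAB (leq_trans (mxrankM_maxl _ _)) // rank_leq_col.
rewrite leqNgt; apply/negP => lt_mk.
have : (m.+1 * m.+2 <= k * k.+1)%N by apply: leq_mul.
by have := double_binS2 m; have := double_binS2 k; lia.
Qed.

(** * Running time and correctness of programs *)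

(* An upper bound for the running time when no loop makes more than [N] turns. *)
Fixpoint loop_cost (R : realType) (N : nat) (c : cmd R) : nat :=
  match c with
  | CSetReg _ e => (ncost e).+1
  | CSetCell _ e r => (ncost e + rcost r).+1
  | COutput r => (rcost r).+1
  | CSeq c1 c2 => loop_cost N c1 + loop_cost N c2
  | CIf b c1 c2 => (tcost b + (loop_cost N c1 + loop_cost N c2)).+1
  | CWhile b c1 => N * (tcost b + loop_cost N c1).+1 + (tcost b).+1
  end%N.

Fixpoint loop_depth (R : realType) (c : cmd R) : nat :=
  match c with
  | CSeq c1 c2 | CIf _ c1 c2 => maxn (loop_depth c1) (loop_depth c2)
  | CWhile _ c1 => (loop_depth c1).+1
  | _ => 0
  end%N.

(** Each level of nesting costs one factor [N]; lower powers are absorbed because [N] is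
    positive. *)
Lemma loop_cost_poly (R : realType) (N : nat) (c : cmd R) :
  (0 < N)%N -> (loop_cost N c <= loop_cost 1 c * N ^ loop_depth c)%N.
Proof.
move=> N_gt0.
have mono a b m : (m <= a * N ^ b -> forall b', b <= b' -> m <= a * N ^ b')%N.
  by move=> le_m b' le_b; rewrite (leq_trans le_m) // leq_mul2l leq_pexp2l ?orbT.
have pow_gt0 b : (0 < N ^ b)%N by rewrite expn_gt0 N_gt0.
elim: c => [x e|a e r|r|c1 IH1 c2 IH2|b c1 IH1 c2 IH2|b c1 IH1] /=.
- by rewrite muln1.
- by rewrite muln1.
- by rewrite muln1.
- have := mono _ _ _ IH1 _ (leq_maxl _ (loop_depth c2)).
  have := mono _ _ _ IH2 _ (leq_maxr (loop_depth c1) _).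
  by rewrite mulnDl; lia.
- have := mono _ _ _ IH1 _ (leq_maxl _ (loop_depth c2)).
  have := mono _ _ _ IH2 _ (leq_maxr (loop_depth c1) _).
  have N_m := pow_gt0 (maxn (loop_depth c1) (loop_depth c2)).
  by have := leq_pmulr (tcost b) N_m; rewrite mulSn !mulnDl; lia.
- have N_d := pow_gt0 (loop_depth c1).
  have N_d1 := pow_gt0 (loop_depth c1).+1.
  have := leq_mul (leqnn N) IH1; have := leq_pmulr (tcost b).+1 N_d1.
  have := leq_pmulr (N * (tcost b).+1) N_d.
  rewrite mul1n !mulSn !mulnDl !expnS; set P := (N ^ _)%N.
  set T := loop_cost _ _; set S := loop_cost _ _; lia.
Qed.

Section Runs.

Variables (R : realType) (N : nat).
Implicit Types (s : state R) (Q : state R -> Prop) (c : cmd R).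

(** Total correctness with a time bound. One [N] bounds the turns of all loops, so the bounds
    compose along [loop_cost]. *)
Definition runs c s Q : Prop :=
  exists t s', [/\ exec c s t s', (t <= loop_cost N c)%N & Q s'].

Lemma runs_weaken c s Q Q' :
  runs c s Q -> (forall s', Q s' -> Q' s') -> runs c s Q'.
Proof. by case=> t [s' [c_s le_t Qs]] QQ'; exists t, s'; split=> //; apply: QQ'. Qed.

Lemma runs_set_reg x e s Q :
  Q (set_reg s x (neval s e)) -> runs (CSetReg R x e) s Q.
Proof. by move=> Qs; do 2!eexists; split; [exact: ExecSetReg | | exact: Qs]. Qed.

Lemma runs_set_cell a e r s Q :
  Q (set_cell s a (neval s e) (reval s r)) -> runs (CSetCell a e r) s Q.
Proof. by move=> Qs; do 2!eexists; split; [exact: ExecSetCell | | exact: Qs]. Qed.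

Lemma runs_output r s Q : Q (add_out s (reval s r)) -> runs (COutput r) s Q.
Proof. by move=> Qs; do 2!eexists; split; [exact: ExecOutput | | exact: Qs]. Qed.

Lemma runs_seq c1 c2 s Q :
  runs c1 s (fun s1 => runs c2 s1 Q) -> runs (CSeq c1 c2) s Q.
Proof.
case=> t1 [s1 [ex1 le1 [t2 [s2 [ex2 le2 Qs2]]]]].
by exists (t1 + t2)%N, s2; split; [exact: ExecSeq ex1 ex2 | exact: leq_add | ].
Qed.

Lemma runs_if b c1 c2 s Q :
  (if teval s b then runs c1 s Q else runs c2 s Q) -> runs (CIf b c1 c2) s Q.
Proof.
move=> H; have [t [s' [ex le_t Qs']]] : exists t s',
    [/\ exec (if teval s b then c1 else c2) s t s',
        (t <= loop_cost N c1 + loop_cost N c2)%N & Q s'].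
  by case: (teval s b) H => -[t [s' [ex le_t Qs']]]; exists t, s'; split=> //;
    lia.
by exists (tcost b + t).+1, s'; split; [exact: ExecIf ex | rewrite /=; lia | ].
Qed.

Lemma runs_while (I : nat -> state R -> Prop) n b c s :
  (n <= N)%N -> I 0%N s ->
  (forall i s, (i < n)%N -> I i s -> teval s b /\ runs c s (I i.+1)) ->
  (forall s, I n s -> ~~ teval s b) ->
  runs (CWhile b c) s (I n).
Proof.
move=> le_nN I0 step stop.
(* Generalize to [m] remaining turns from turn [i]; the summand [(tcost b).+1] pays for the final,
   failing test. *)
suff H m i s1 : (m + i = n)%N -> I i s1 -> exists t s',
    [/\ exec (CWhile b c) s1 t s',
        (t <= m * (tcost b + loop_cost N c).+1 + (tcost b).+1)%N & I n s'].
  have [t [s' [ex le_t In]]] := H n 0%N s (addn0 n) I0.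
  exists t, s'; split=> //=; rewrite (leq_trans le_t) // leq_add2r.
  by rewrite leq_mul2r le_nN orbT.
elim: m i s1 => [|m IHm] i s1 eq_n Ii.
  move: Ii; rewrite -[i]add0n eq_n => In.
  by exists (tcost b).+1, s1; split=> //; apply/ExecWhileEnd/stop.
have [|tb [t1 [s2 [ex1 le1 Ii1]]]] := step i s1 _ Ii; first by lia.
have [|t2 [s' [ex2 le2 In]]] := IHm i.+1 s2 _ Ii1; first by lia.
exists (tcost b + t1 + t2).+1, s'; split=> //; last by lia.
exact: ExecWhileStep ex1 ex2.
Qed.

(* The counter [x] is zero outside of the loop. *)
Definition CFor (x z : nat) c : cmd R :=
  CSeq (CWhile (TNot (TNatLe R (NReg z) (NReg x)))
          (CSeq c (CSetReg R x (NAdd (NReg x) (NConst 1)))))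
       (CSetReg R x (NConst 0)).

Lemma runs_for (I : nat -> state R -> Prop) n x z c s Q :
  (n <= N)%N -> st_reg s x = 0%N -> st_reg s z = n -> I 0%N s ->
  (forall i s, (i < n)%N -> st_reg s x = i -> st_reg s z = n -> I i s ->
     runs c s (fun s' => [/\ st_reg s' x = i, st_reg s' z = n
                           & I i.+1 (set_reg s' x i.+1)])) ->
  x != z ->
  (forall s', I n s' -> Q (set_reg s' x 0)) ->
  runs (CFor x z c) s Q.
Proof.
move=> le_nN sx sz I0 step nxz IQ; apply: runs_seq.
pose J i s := [/\ st_reg s x = i, st_reg s z = n & I i s].
apply: (@runs_weaken _ _ (J n)) => [|s' [_ _ In]]; last exact/runs_set_reg/IQ.
apply: runs_while => // [i s1 lt_in [sx1 sz1 Ii]|s1 [sx1 sz1 _] /=]; last first.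
  by rewrite sx1 sz1 leqnn.
split; first by rewrite /= sx1 sz1 -ltnNge.
apply: runs_seq; apply: runs_weaken (step i s1 lt_in sx1 sz1 Ii) _.
move=> s2 [sx2 sz2 Ii1]; apply: runs_set_reg; rewrite /= sx2 addn1.
by split; rewrite //= ?eqxx // eq_sym (negPf nxz).
Qed.

(* From registers [rho] and arrays [cell], the program appends [w] to the
   output and restores the registers. *)
Definition emits c (rho : nat -> nat) (cell : nat -> nat -> R) (w : seq R) :
    Prop :=
  forall o, runs c (State rho cell o) (eq (State rho cell (o ++ w))).

Definition set_rho (rho : nat -> nat) (x n : nat) : nat -> nat :=
  fun y => if y == x then n else rho y.

(** Because of this the reset that ends [CFor] restores the registers exactly, and nested loops can
    be described by equalities of states. *)
Lemma set_rho_id rho x : rho x = 0%N -> set_rho rho x 0 = rho.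
Proof. by move=> rx; apply/funext => y; rewrite /set_rho; case: eqP => // ->. Qed.

Lemma set_rho_set rho x m n : set_rho (set_rho rho x m) x n = set_rho rho x n.
Proof. by apply/funext => y; rewrite /set_rho; case: eqP. Qed.

Lemma set_reg_rho rho cell o x n :
  set_reg (State rho cell o : state R) x n = State (set_rho rho x n) cell o.
Proof. by []. Qed.

Lemma emits_output r rho cell v :
  (forall o, reval (State rho cell o) r = v) ->
  emits (COutput r) rho cell [:: v].
Proof. by move=> rv o; apply: runs_output; rewrite rv /add_out /= cats1. Qed.

Lemma emits_seq c1 c2 rho cell w1 w2 :
  emits c1 rho cell w1 -> emits c2 rho cell w2 ->
  emits (CSeq c1 c2) rho cell (w1 ++ w2).
Proof.
move=> e1 e2 o; apply: runs_seq; apply: runs_weaken (e1 o) _ => _ <-.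
by rewrite catA; apply: e2.
Qed.

Lemma emits_for n x z c rho cell (w : 'I_n -> seq R) :
  (n <= N)%N -> rho x = 0%N -> rho z = n -> x != z ->
  (forall i : 'I_n, emits c (set_rho rho x i) cell (w i)) ->
  emits (CFor x z c) rho cell (flatten [seq w i | i <- enum 'I_n]).
Proof.
move=> le_nN rx rz nxz step o.
pose I i s := s = State (set_rho rho x i) cell
                    (o ++ flatten [seq w j | j <- take i (enum 'I_n)]).
apply: (@runs_for I n) => // [|i s lt_in sx sz Is|s ->].
- by rewrite /I take0 cats0 set_rho_id.
- rewrite Is; apply: runs_weaken (step (Ordinal lt_in) _) _ => _ <-.
  split=> /=; rewrite ?{1}/set_rho ?eqxx // 1?eq_sym ?(negPf nxz) //.
  rewrite /I set_reg_rho set_rho_set; congr State.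
  rewrite (take_nth (Ordinal lt_in)) ?size_enum_ord // map_rcons flatten_rcons.
  by rewrite catA; congr (_ ++ w _); apply/val_inj; rewrite /= nth_enum_ord.
- by rewrite take_oversize ?size_enum_ord // set_reg_rho set_rho_set set_rho_id.
Qed.

End Runs.

(** * Printing the system *)

(** Lists of pairs define the words, while nested loops print the right-hand side. *)
Lemma flatten_map_allpairs (S T U V : Type) (f : S -> T -> U) (h : U -> seq V)
    (s : seq S) (t : seq T) :
  flatten [seq h u | u <- [seq f x y | x <- s, y <- t]] =
  flatten [seq flatten [seq h (f x y) | y <- t] | x <- s].
Proof.
elim: s => [|x s IHs] //=.
by rewrite map_cat flatten_cat -map_comp IHs.
Qed.

Lemma mx_wordE (R : realType) (m n : nat) (A : 'M[R]_(m, n)) :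
  mx_word A =
  flatten [seq flatten [seq [:: A i j] | j <- enum 'I_n] | i <- enum 'I_m].
Proof.
rewrite -(flatten_map_allpairs (fun i j => A i j) (fun a => [:: a])).
by rewrite flatten_map1 map_id.
Qed.

Definition nmul2 (e : nexp) : nexp := NMul (NConst 2) e.
Definition nmax (e1 e2 : nexp) : nexp := NAdd e1 (NSub e2 e1).
Definition nmin (e1 e2 : nexp) : nexp := NSub e1 (NSub e1 e2).

(* Truncated subtraction makes this the truth value, 0 or 1, of [e1 = e2]. *)
Definition neqb (e1 e2 : nexp) : nexp :=
  NSub (NConst 1) (NAdd (NSub e1 e2) (NSub e2 e1)).

Lemma subn_eqb (m n : nat) : (1 - (m - n + (n - m)) = (m == n))%N.
Proof. by case: eqP; lia. Qed.

Lemma addn_subn_max (m n : nat) : (m + (n - m) = maxn m n)%N.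
Proof. by lia. Qed.

Lemma subn_subn_min (m n : nat) : (m - (m - n) = minn m n)%N.
Proof. by lia. Qed.

(* Entry [(x, y)] of the symmetric matrix with coordinate vector [e_a]; the
   equation [a = sym_idx x y] is doubled to avoid the division in the binomial. *)
Definition unit_entry (R : realType) (a x y : nexp) : rexp R :=
  RMul (RNat R (neqb (nmul2 a)
                  (NAdd (NMul (nmax x y) (NAdd (nmax x y) (NConst 1)))
                        (nmul2 (nmin x y)))))
       (RAdd (RNat R (neqb x y))
             (RMul (RNat R (NSub (NConst 1) (neqb x y)))
                   (RConst (Num.sqrt 2)^-1))).

Lemma reval_unit_entry (R : realType) (k : nat) (s : state R) (ea ex ey : nexp)
    (a : 'I_('C(k.+1, 2))) (x y : 'I_k) :
  neval s ea = a -> neval s ex = x -> neval s ey = y ->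
  reval s (unit_entry R ea ex ey) = sym_of_vec (delta_mx 0 a) x y.
Proof.
move=> ha hx hy; rewrite sym_of_vecE mxE eqxx /=.
rewrite /= ha hx hy !subn_eqb !addn_subn_max !subn_subn_min /sym_scale.
have -> : (2 * a == maxn x y * (maxn x y + 1) + 2 * minn x y)%N =
          (sym_idx x y == a).
  rewrite -[RHS]val_eqE /= addn1 -double_binS2.
  by apply/eqP/eqP; lia.
congr (_ * _); rewrite -val_eqE /=.
by case: eqP => _; rewrite ?mul0r ?mul1r ?addr0 ?add0r.
Qed.

(** Register 2 holds [d], so these compute [Lvar] and [Kvar]. *)
Definition Lexp (a b : nexp) : nexp := NAdd (NMul a (NReg 2)) b.
Definition Kexp (a b : nexp) : nexp := NAdd (NMul (NReg 2) (NReg 2)) (Lexp a b).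

Definition out_eqs (R : realType) (X Y : nexp -> nexp -> nexp) : cmd R :=
  CFor 4 2 (CFor 5 2
    (CSeq (COutput (RNat R (NReg 2)))
    (CSeq (CFor 6 2
             (CSeq (COutput (RConst 1))
             (CSeq (COutput (RNat R (X (NReg 4) (NReg 6))))
                   (COutput (RNat R (Y (NReg 6) (NReg 5)))))))
          (COutput (RNat R (neqb (NReg 4) (NReg 5))))))).

(** The inequalities for rows and for columns differ only in these parameters: the register bounding
    the outer loop, the unknown, its coefficient and the index of the basis matrix. *)
Definition out_lmis (R : realType) (z : nat) (var : nexp) (coef : rexp R)
    (sel : nexp) : cmd R :=
  CFor 4 z
    (CSeq (COutput (RNat R (NMul (NReg 2) (NReg 2))))
          (CFor 5 2 (CFor 6 2
             (CSeq (COutput (RNat R var))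
                   (CFor 7 3 (CFor 8 3
                      (COutput (RMul coef
                         (unit_entry R sel (NReg 7) (NReg 8)))))))))).

Section Output.

Variables (R : realType) (N k p q : nat).
Let d := 'C(k.+1, 2).
Hypotheses (le_pN : (p <= N)%N) (le_qN : (q <= N)%N) (le_dN : (d <= N)%N)
  (le_kN : (k <= N)%N).
Variable cell : nat -> nat -> R.

Definition out_regs : nat -> nat := nth 0%N [:: p; q; d; k].
Let rho := out_regs.

Lemma emits_eqs (X Y : 'I_d -> 'I_d -> nat) (eX eY : nexp -> nexp -> nexp) :
  (forall (s : state R) ea eb (a b : 'I_d), st_reg s 2 = d -> neval s ea = a ->
     neval s eb = b -> neval s (eX ea eb) = X a b) ->
  (forall (s : state R) ea eb (a b : 'I_d), st_reg s 2 = d -> neval s ea = a ->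
     neval s eb = b -> neval s (eY ea eb) = Y a b) ->
  emits N (out_eqs R eX eY) rho cell
    (flatten [seq quad_eq_word e | e <- inverse_eqs R X Y]).
Proof.
move=> hX hY; rewrite flatten_map_allpairs.
apply: emits_for => // i; apply: emits_for => // j.
rewrite /quad_eq_word /= size_map size_enum_ord -map_comp.
rewrite -cat1s; apply: emits_seq; first by apply: emits_output.
apply: emits_seq; last first.
  by apply: emits_output => o; rewrite /= subn_eqb.
apply: emits_for => // m; rewrite -[X in emits _ _ _ _ X]cat1s /=.
rewrite -cat1s; apply: emits_seq; first by apply: emits_output.
rewrite -cat1s; apply: emits_seq; apply: emits_output => o /=.
  by rewrite (hX _ _ _ i m).
by rewrite (hY _ _ _ m j).
Qed.

(** [rho3] and [rho5] are the registers inside three and five nested loops; [z < 4] keeps the bound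
    of the outer loop apart from the counters. *)
Lemma emits_lmis (n z : nat) (var : nexp) (coef : rexp R) (sel : nexp)
    (v : 'I_d -> 'I_d -> nat) (c : 'I_n -> 'I_d -> 'I_d -> R)
    (sl : 'I_d -> 'I_d -> 'I_d) (F : 'I_n -> lmi R k) :
  let rho3 (i : 'I_n) (a b : 'I_d) :=
    set_rho (set_rho (set_rho rho 4 i) 5 a) 6 b in
  let rho5 i a b (x y : 'I_k) := set_rho (set_rho (rho3 i a b) 7 x) 8 y in
  (n <= N)%N -> rho z = n -> (z < 4)%N ->
  (forall i a b o, neval (State (rho3 i a b) cell o) var = v a b) ->
  (forall i a b x y o,
     reval (State (rho5 i a b x y) cell o) coef = c i a b) ->
  (forall i a b x y o,
     neval (State (rho5 i a b x y) cell o) sel = sl a b) ->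
  (forall i, F i = Lmi [seq (v a b, c i a b *: sym_of_vec (delta_mx 0 (sl a b)))
                          | a <- enum 'I_d, b <- enum 'I_d]) ->
  emits N (out_lmis z var coef sel) rho cell
    (flatten [seq lmi_word l | l <- [seq F i | i <- enum 'I_n]]).
Proof.
move=> rho3 rho5 le_nN rz lt_z4 hv hc hs hF; rewrite -map_comp.
apply: emits_for => // [|i /=]; first by rewrite neq_ltn lt_z4 orbT.
rewrite hF /lmi_word /= size_allpairs !size_enum_ord -cat1s.
apply: emits_seq; first by apply: emits_output.
rewrite flatten_map_allpairs.
apply: emits_for => // a; apply: emits_for => // b.
rewrite -cat1s; apply: emits_seq.
  by apply: emits_output => o /=; rewrite hv.
rewrite mx_wordE; apply: emits_for => // x; apply: emits_for => // y.
apply: emits_output => o; rewrite mxE.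
rewrite -(hc i a b x y o).
have sel_a := hs i a b x y o.
by rewrite -(@reval_unit_entry _ _ _ _ (NReg 7) (NReg 8) _ x y sel_a).
Qed.

Definition out_system : cmd R :=
  CSeq (COutput (RNat R (nmul2 (NMul (NReg 2) (NReg 2)))))
  (CSeq (COutput (RNat R (NReg 3)))
  (CSeq (COutput (RNat R (nmul2 (NMul (NReg 2) (NReg 2)))))
  (CSeq (COutput (RNat R (NAdd (NReg 0) (NReg 1))))
  (CSeq (CSeq (out_eqs R Lexp Kexp) (out_eqs R Kexp Lexp))
  (CSeq (out_lmis 0 (Kexp (NReg 5) (NReg 6))
           (RCell R 1 (NAdd (NMul (NReg 6) (NReg 0)) (NReg 4))) (NReg 5))
        (out_lmis 1 (Lexp (NReg 5) (NReg 6))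
           (RCell R 2 (NAdd (NMul (NReg 5) (NReg 1)) (NReg 4))) (NReg 6))))))).

(** [U] is stored by columns and [V] by rows, so a new rank-one term is appended after the earlier
    ones in both arrays. *)
Lemma emits_system :
  emits N out_system rho cell
    (system_word (psd_system_of
       (\matrix_(i < p, l < d) cell 1%N (l * p + i))
       (\matrix_(l < d, j < q) cell 2%N (l * q + j)))).
Proof.
rewrite /system_word /= !size_cat !size_allpairs !(size_enum_ord, size_map).
do 4!(rewrite -[X in emits _ _ _ _ X]cat1s; apply: emits_seq;
  first by apply: emits_output => o /=; rewrite ?mul2n -?addnn).
rewrite !map_cat !flatten_cat; apply: emits_seq; first apply: emits_seq.
- by apply: emits_eqs => s ea eb a b /= -> -> ->.
- by apply: emits_eqs => s ea eb a b /= -> -> ->.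
apply: emits_seq.
  apply: (@emits_lmis _ _ _ _ _ (@Kvar d) (fun i a b => cell 1%N (b * p + i))
    (fun a b => a)) => // i; congr Lmi; congr flatten.
  by apply: eq_map => a; apply: eq_map => b; rewrite mxE.
apply: (@emits_lmis _ _ _ _ _ (@Lvar d) (fun j a b => cell 2%N (a * q + j))
  (fun a b => b)) => // i; congr Lmi; congr flatten.
by apply: eq_map => a; apply: eq_map => b; rewrite mxE.
Qed.

End Output.

(** * Computing a rank factorization *)

(* The new matrix is a left multiple of [W] whose column [j] vanishes, which
   excludes row [i] of [W] from its row space. *)
Lemma rank_peel (F : fieldType) (p q : nat) (W : 'M[F]_(p, q)) (i : 'I_p)
    (j : 'I_q) :
  W i j != 0 ->
  (\rank (W - (W i j)^-1 *: (col j W *m row i W))%R < \rank W)%N.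
Proof.
move=> Wij; set W' := W - _; apply: rank_ltmx; rewrite ltmxE.
have eW' : W' = (1%:M - (W i j)^-1 *: (col j W *m delta_mx 0 i)) *m W.
  by rewrite mulmxBl mul1mx -scalemxAl -mulmxA -rowE.
have W'j : W' *m delta_mx j (0 : 'I_1) = 0.
  apply/matrixP => a b; rewrite -colE !mxE big_ord1 !mxE.
  by rewrite mulrCA mulVf // mulr1 subrr.
apply/andP; split; first by rewrite eW' submxMl.
apply/negP => /submxP [D eW].
have : (W *m delta_mx j (0 : 'I_1)) i 0 = 0.
  by rewrite eW -mulmxA W'j mulmx0 mxE.
by rewrite -colE mxE => /eqP; apply/negP.
Qed.

Lemma nth_mx_word (R : realType) (m n : nat) (A : 'M[R]_(m, n)) (i : 'I_m)
    (j : 'I_n) :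
  nth 0 (mx_word A) (i * n + j) = A i j.
Proof.
rewrite /mx_word.
suff H (s : seq 'I_m) a : (a < size s)%N ->
    nth 0 [seq A i j | i <- s, j <- enum 'I_n] (a * n + j) = A (nth i s a) j.
  by rewrite H ?size_enum_ord // nth_ord_enum.
elim: s a => [|x s IHs] [|a] //= lt_a.
  rewrite mul0n add0n nth_cat size_map size_enum_ord ltn_ord.
  by rewrite (nth_map j) ?size_enum_ord // nth_ord_enum.
rewrite nth_cat size_map size_enum_ord mulSn -addnA ltnNge leq_addr /= addKn.
exact: IHs.
Qed.

(** * Loops that fill a segment of an array *)

Section Fill.

Variables (R : realType) (N : nat).

(** A closed form for the effect of a writing loop, which lets memories be compared as functions. *)
Definition fill (arr base n : nat) (f : nat -> R) (cell : nat -> nat -> R) :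
    nat -> nat -> R :=
  fun b t => if (b == arr) && (base <= t < base + n)%N then f (t - base)%N
             else cell b t.

Lemma fill0 arr base f cell : fill arr base 0 f cell = cell.
Proof.
apply/funext => b; apply/funext => t; rewrite /fill addn0.
by case: ifP => // /andP[_]; lia.
Qed.

Lemma fill_cat arr base n1 n2 f g cell :
  (forall i, (i < n2)%N -> g i = f (n1 + i)%N) ->
  fill arr (base + n1) n2 g (fill arr base n1 f cell) =
  fill arr base (n1 + n2) f cell.
Proof.
move=> gE; apply/funext => b; apply/funext => t; rewrite /fill.
case: (b == arr) => //=; case: ifP => h1; case: ifP => h2 //;
  try case: ifP => h3 //.
- by rewrite gE; [congr f; lia | lia].
- by lia.
- by lia.
- by lia.
Qed.

Lemma fill_out arr base n f cell t :
  ~~ (base <= t < base + n)%N -> fill arr base n f cell arr t = cell arr t.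
Proof. by rewrite /fill eqxx /= => /negPf ->. Qed.

Lemma fill_in arr base n f cell i :
  (i < n)%N -> fill arr base n f cell arr (base + i) = f i.
Proof. by move=> lt_in; rewrite /fill eqxx leq_addr ltn_add2l lt_in addKn. Qed.

Lemma fill_other arr base n f cell b t :
  b != arr -> fill arr base n f cell b t = cell b t.
Proof. by rewrite /fill => /negPf ->. Qed.

(** Turn [i] writes the [i]-th block of length [m]. Length 1 gives a simple loop, and length [q] the
    row-by-row update of a matrix. *)
Lemma runs_for_fill (n m x z arr base : nat) (f : nat -> R) c rho cell o :
  (n <= N)%N -> rho x = 0%N -> rho z = n -> x != z ->
  (forall i, (i < n)%N ->
     runs N c (State (set_rho rho x i) (fill arr base (i * m) f cell) o)
       (eq (State (set_rho rho x i)
              (fill arr (base + i * m) m (fun l => f (i * m + l)%N)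
                 (fill arr base (i * m) f cell)) o))) ->
  runs N (CFor x z c) (State rho cell o)
    (eq (State rho (fill arr base (n * m) f cell) o)).
Proof.
move=> le_nN rx rz nxz step.
pose I i s := s = State (set_rho rho x i) (fill arr base (i * m) f cell) o.
apply: (@runs_for _ _ I n) => // [|i s lt_in sx sz ->|s ->].
- by rewrite /I mul0n fill0 set_rho_id.
- apply: runs_weaken (step i lt_in) _ => _ <-.
  split=> /=; rewrite ?{1}/set_rho ?eqxx // 1?eq_sym ?(negPf nxz) //.
  by rewrite /I set_reg_rho set_rho_set fill_cat // mulSn addnC.
- by rewrite set_reg_rho set_rho_set set_rho_id.
Qed.

Lemma runs_fill (n x z arr base : nat) (f : nat -> R) e r rho cell o :
  (n <= N)%N -> rho x = 0%N -> rho z = n -> x != z ->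
  (forall i, (i < n)%N ->
     let s := State (set_rho rho x i) (fill arr base i f cell) o in
     neval s e = (base + i)%N /\ reval s r = f i) ->
  runs N (CFor x z (CSetCell arr e r)) (State rho cell o)
    (eq (State rho (fill arr base n f cell) o)).
Proof.
move=> le_nN rx rz nxz step; rewrite -[n in fill _ _ n]muln1.
apply: runs_for_fill => // i lt_in; rewrite muln1; apply: runs_set_cell.
have [-> ->] := step i lt_in; rewrite /set_cell /=; congr State.
apply/funext => b; apply/funext => t; rewrite {1}/fill addn1 ltnS -eqn_leq.
rewrite [(_ + i)%N == t]eq_sym.
by case: ifP => // /andP[_ /eqP->]; rewrite subnn addn0.
Qed.

End Fill.

(* Registers 0 to 3 hold p, q, the number of rank-one terms found so far and k;
   the others are loop counters.  Array 0 holds M minus the terms found, and the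
   entries U_al and V_lb of the l-th term are stored at [l * p + a] in array 1
   and at [l * q + b] in array 2. *)
Definition at2 (row width col : nat) : nexp :=
  NAdd (NMul (NReg row) (NReg width)) (NReg col).

(** The scaled pivot column and the pivot row are saved first, since updating array 0 destroys
    both. *)
Definition peel (R : realType) : cmd R :=
  CSeq (CFor 6 0 (CSetCell 1 (at2 2 0 6)
          (RDiv (RCell R 0 (at2 6 1 5)) (RCell R 0 (at2 4 1 5)))))
  (CSeq (CFor 7 1 (CSetCell 2 (at2 2 1 7) (RCell R 0 (at2 4 1 7))))
  (CSeq (CFor 6 0 (CFor 7 1 (CSetCell 0 (at2 6 1 7)
          (RSub (RCell R 0 (at2 6 1 7))
                (RMul (RCell R 1 (at2 2 0 6)) (RCell R 2 (at2 2 1 7)))))))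
        (CSetReg R 2 (NAdd (NReg 2) (NConst 1))))).

(* The test [w * w <= 0] stands for [w = 0]. *)
Definition factorize (R : realType) : cmd R :=
  CFor 4 0 (CFor 5 1
    (CIf (TRealLe (RMul (RCell R 0 (at2 4 1 5)) (RCell R 0 (at2 4 1 5)))
                  (RConst 0))
         (CSetReg R 2 (NReg 2))
         (peel R))).

(** Recovers [k] from [d] by counting up, as register expressions have neither division nor
    roots. *)
Definition find_size (R : realType) : cmd R :=
  CWhile (TNot (TNatLe R (nmul2 (NReg 2))
                         (NMul (NReg 3) (NAdd (NReg 3) (NConst 1)))))
         (CSetReg R 3 (NAdd (NReg 3) (NConst 1))).

Section Factorize.

Variables (R : realType) (p q : nat) (M : 'M[R]_(p, q)).
Let N := (p * q)%N.

Definition residue (cell : nat -> nat -> R) : 'M[R]_(p, q) :=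
  \matrix_(a, b) cell 0%N (a * q + b)%N.

(** Here [n] entries have been scanned and [r] terms found. The rank inequality keeps [r] from
    exceeding the rank of [M]. *)
Definition peel_inv (n r : nat) (cell : nat -> nat -> R) : Prop :=
  [/\ forall (a : 'I_p) (b : 'I_q), M a b =
        residue cell a b +
        \sum_(l < r) cell 1%N (l * p + a)%N * cell 2%N (l * q + b)%N,
      (r + \rank (residue cell) <= \rank M)%N
    & forall (a : 'I_p) (b : 'I_q), (a * q + b < n)%N -> residue cell a b = 0].

Definition peeled (i j r : nat) (cell : nat -> nat -> R) : nat -> nat -> R :=
  let u a := cell 0%N (a * q + j)%N / cell 0%N (i * q + j)%N in
  let v b := cell 0%N (i * q + b)%N in
  fill 0 0 (p * q) (fun t => cell 0%N t - u (t %/ q)%N * v (t %% q)%N)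
    (fill 2 (r * q) q v (fill 1 (r * p) p u cell)).

Let start (r : nat) : nat -> nat := nth 0%N [:: p; q; r].
Let regs (r i j : nat) := set_rho (set_rho (start r) 4 i) 5 j.

Lemma set_reg_regs r r' i j cell o :
  set_reg (State (regs r i j) cell o : state R) 2 r' = State (regs r' i j) cell o.
Proof.
rewrite /set_reg /=; congr State; apply/funext => y.
by rewrite /regs /start /set_rho; do 3?case: y => [|y] //.
Qed.

Lemma runs_peel i j r cell o :
  (i < p)%N -> (j < q)%N ->
  runs N (peel R) (State (regs r i j) cell o)
    (eq (State (regs r.+1 i j) (peeled i j r cell) o)).
Proof.
move=> lt_ip lt_jq.
have le_pN : (p <= N)%N by rewrite /N leq_pmulr //; lia.
have le_qN : (q <= N)%N by rewrite /N leq_pmull //; lia.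
have q_gt0 : (0 < q)%N by lia.
set u := fun a => cell 0%N (a * q + j)%N / cell 0%N (i * q + j)%N.
set v := fun b => cell 0%N (i * q + b)%N.
apply: runs_seq.
apply: (@runs_weaken _ _ _ _
    (eq (State (regs r i j) (fill 1 (r * p) p u cell) o))).
  by apply: runs_fill => // a lt_ap; split; rewrite //= !fill_other.
move=> _ <-; apply: runs_seq.
apply: (@runs_weaken _ _ _ _ (eq (State (regs r i j)
    (fill 2 (r * q) q v (fill 1 (r * p) p u cell)) o))).
  by apply: runs_fill => // b lt_bq; split; rewrite //= !fill_other.
move=> _ <-; apply: runs_seq.
apply: (@runs_weaken _ _ _ _ (eq (State (regs r i j) (peeled i j r cell) o))).
  apply: runs_for_fill => // a lt_ap; apply: runs_fill => // b lt_bq.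
  (* The entry at [a * q + b] is still the old one when it is read: the fills for the rows above and
     for the cells to its left end before it. *)
  split=> //=; rewrite !add0n /regs /start /set_rho /= fill_out; last by lia.
  rewrite fill_out; last by lia.
  rewrite !(@fill_other _ 0) // (@fill_other _ 2 _ _ _ _ 1%N) // !fill_in //.
  rewrite !(@fill_other _ 2) // !(@fill_other _ 1) //.
  by rewrite divnMDl // modnMDl divn_small // modn_small // addn0.
move=> _ <-; apply: runs_set_reg.
by rewrite set_reg_regs /= addn1.
Qed.

Lemma residue_peeled (i : 'I_p) (j : 'I_q) r cell :
  residue (peeled i j r cell) = residue cell -
    (residue cell i j)^-1 *: (col j (residue cell) *m row i (residue cell)).
Proof.
apply/matrixP => a b; rewrite !mxE big_ord1 !mxE /peeled.
have lt_ab : (a * q + b < p * q)%N by have := ltn_ord a; have := ltn_ord b; nia.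
have q_gt0 : (0 < q)%N by have := ltn_ord b; lia.
rewrite -{1}[(a * q + b)%N]add0n fill_in //.
rewrite divnMDl // modnMDl divn_small // modn_small // addn0.
by congr (_ - _); rewrite mulrA [_^-1 * _]mulrC.
Qed.

Lemma peel_inv_peel (i : 'I_p) (j : 'I_q) r cell :
  peel_inv (i * q + j) r cell -> residue cell i j != 0 ->
  peel_inv (i * q + j).+1 r.+1 (peeled i j r cell).
Proof.
case=> eqM le_r zero nz_ij; rewrite /peel_inv residue_peeled.
set W := residue cell in eqM le_r zero nz_ij *.
split=> [a b||a b lt_ab].
- rewrite eqM big_ord_recr /= /peeled !(@fill_other _ 0) //.
  rewrite (@fill_other _ 2 _ _ _ _ 1%N) // !fill_in //.
  (* The earlier terms are unchanged: their segments lie below [r * p] in array 1 and below [r * q]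
     in array 2. *)
  rewrite [X in _ + (X + _)](eq_bigr (fun l : 'I_r =>
    cell 1%N (l * p + a)%N * cell 2%N (l * q + b)%N));
    last first.
    move=> l _; rewrite !(@fill_other _ 0) // (@fill_other _ 2 _ _ _ _ 1%N) //.
    have := ltn_ord l; have := ltn_ord a; have := ltn_ord b => ? ? ?.
    by rewrite !fill_out //; nia.
  by rewrite !mxE big_ord1 !mxE; ring.
- by rewrite addSn -ltnS -addnS; apply: leq_trans le_r; rewrite leq_add2l rank_peel.
have := ltn_ord j; have := ltn_ord b => lt_bq lt_jq.
have -> : (W - (W i j)^-1 *: (col j W *m row i W)) a b =
    W a b - (W i j)^-1 * (W a j * W i b) by rewrite !mxE big_ord1 !mxE.
(* Rows above the pivot are already zero, in column [j] too, so nothing is subtracted from them. Any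
   other scanned entry lies in row [i], which the subtraction clears. *)
have [lt_ai|le_ia] := ltnP a i.
  have le_aq : (a.+1 * q <= i * q)%N by rewrite leq_mul2r lt_ai orbT.
  rewrite (zero a b) ?(zero a j) ?mul0r ?mulr0 ?subr0 //; lia.
have -> : a = i.
  apply/val_inj/anti_leq; rewrite le_ia andbT /= leqNgt; apply/negP => lt_ia.
  by have : (i.+1 * q <= a * q)%N; [rewrite leq_mul2r lt_ia orbT | lia].
by rewrite mulKf // subrr.
Qed.

Lemma peel_inv_skip (i : 'I_p) (j : 'I_q) r cell :
  peel_inv (i * q + j) r cell -> residue cell i j = 0 ->
  peel_inv (i * q + j).+1 r cell.
Proof.
case=> eqM le_r zero z_ij; split=> // a b.
rewrite ltnS leq_eqVlt => /orP[/eqP eq_ab|/zero //].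
have q_gt0 : (0 < q)%N by have := ltn_ord b; lia.
have eqai : a = i.
  apply/val_inj; have := congr1 (divn^~ q) eq_ab.
  by rewrite !divnMDl // !divn_small // !addn0.
suff -> : b = j by rewrite eqai.
by apply/val_inj; move: eq_ab; rewrite eqai => /addnI.
Qed.

Lemma runs_factorize cell :
  (0 < p)%N -> (0 < q)%N ->
  peel_inv 0 0 cell ->
  runs N (factorize R) (State (start 0) cell [::])
    (fun s => exists r cell',
       s = State (start r) cell' [::] /\ peel_inv N r cell').
Proof.
move=> p_gt0 q_gt0 inv0.
(* [I] holds at the start of a row and [J] inside it; they match at the end of a row because
   [i * q + q = i.+1 * q]. *)
pose I i s := exists r cell',
  s = State (set_rho (start r) 4 i) cell' [::] /\ peel_inv (i * q) r cell'.
pose J i j s := exists r cell',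
  s = State (regs r i j) cell' [::] /\ peel_inv (i * q + j) r cell'.
have le_pN : (p <= N)%N by rewrite /N leq_pmulr.
have le_qN : (q <= N)%N by rewrite /N leq_pmull.
apply: (@runs_for _ _ I p) => //
  [|i s lt_ip _ _ [r [cell1 [-> inv1]]]|s [r [cell1 [-> inv1]]]].
- by exists 0%N, cell; rewrite set_rho_id.
- apply: (@runs_for _ _ (J i) q) => //
    [|j s2 lt_jq _ _ [r2 [cell2 [-> inv2]]]|s2 [r2 [cell2 [-> inv2]]]].
  + by exists r, cell1; rewrite addn0 /regs set_rho_id.
  + apply: runs_if => /=.
    case: ifP => w_le0.
      (* This branch assigns register 2 to itself, so it changes nothing; the entry vanishes since
         its square is at most zero. *)
      apply: runs_set_reg; rewrite set_reg_regs /=; split=> //.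
      exists r2, cell2; split.
        by rewrite set_reg_rho /regs set_rho_set.
      rewrite addnS; apply: (@peel_inv_skip (Ordinal lt_ip) (Ordinal lt_jq)) => //.
      rewrite mxE /=; apply/eqP.
      by rewrite -sqrf_eq0 expr2 eq_le w_le0 -expr2 sqr_ge0.
    apply: runs_weaken (runs_peel r2 cell2 [::] lt_ip lt_jq) _ => _ <-.
    split=> //.
    eexists; eexists; split.
      by rewrite set_reg_rho /regs set_rho_set.
    rewrite addnS; apply: (@peel_inv_peel (Ordinal lt_ip) (Ordinal lt_jq)) => //.
    by rewrite mxE /=; apply: contraFneq w_le0 => ->; rewrite mul0r.
  + rewrite set_reg_rho /regs set_rho_set set_rho_id; split=> //.
    exists r2, cell2; split.
      by rewrite set_reg_rho set_rho_set.
    by rewrite mulSn addnC.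
- exists r, cell1; split=> //.
  by rewrite set_reg_rho set_rho_set set_rho_id.
Qed.
Lemma peel_inv_input : peel_inv 0 0 (st_cell (input_state M)).
Proof.
have res : residue (st_cell (input_state M)) = M.
  by apply/matrixP => a b; rewrite mxE /= nth_mx_word.
by split=> [a b||//]; rewrite ?big_ord0 res ?addr0.
Qed.

(** Once all entries are scanned the residue is zero, so [M] is the sum of the [r] terms and has
    rank at most [r]; the invariant gives the converse inequality. *)
Lemma peel_inv_factor r cell : peel_inv N r cell ->
  M = (\matrix_(i < p, l < r) cell 1%N (l * p + i)%N) *m
      (\matrix_(l < r, j < q) cell 2%N (l * q + j)%N) /\ r = \rank M.
Proof.
case=> eqM le_r zero.
have res0 : residue cell = 0.
  apply/matrixP => a b; rewrite zero ?mxE //.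
  by have := leq_mul (ltn_ord a) (leqnn q); have := ltn_ord b; rewrite /N; lia.
have eM : M = (\matrix_(i < p, l < r) cell 1%N (l * p + i)%N) *m
              (\matrix_(l < r, j < q) cell 2%N (l * q + j)%N).
  apply/matrixP => a b; rewrite eqM res0 !mxE add0r.
  by apply: eq_bigr => l _; rewrite !mxE.
split=> //; apply/anti_leq/andP; split.
  by move: le_r; rewrite res0 mxrank0 addn0.
by rewrite eM (leq_trans (mxrankM_maxl _ _)) // rank_leq_col.
Qed.

End Factorize.

Lemma runs_find_size (R : realType) (N k p q : nat) cell :
  (k <= N)%N ->
  runs N (find_size R) (State (nth 0%N [:: p; q; 'C(k.+1, 2)]) cell [::])
    (eq (State (out_regs k p q) cell [::])).
Proof.
move=> le_kN.
pose I i s := State (nth 0%N [:: p; q; 'C(k.+1, 2); i]) cell [::] = s :> state R.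
have e2 : (2 * 'C(k.+1, 2) = k * (k + 1))%N by rewrite mulnC double_binS2 addn1.
apply: (@runs_while _ _ I) => // [|i s lt_ik <-|s <-].
- rewrite /I; congr State; apply/funext => y.
  by do 4?case: y => [|y] //; rewrite /= !nth_nil.
- split.
    rewrite /= e2 -ltnNge addn1 addn1.
    by apply: (@leq_ltn_trans (i * k.+1)%N); rewrite ?ltn_mul2r // leq_mul2l; lia.
  apply: runs_set_reg; rewrite /I /set_reg /= addn1; congr State.
  by apply/funext => y; do 4?case: y => [|y] //.
- by rewrite /= e2 leqnn.
Qed.

(** * The complete program and its running time *)

Definition system_program (R : realType) : cmd R :=
  CSeq (factorize R) (CSeq (find_size R) (out_system R)).

Lemma runs_system_program (R : realType) (k p q : nat) (M : 'M[R]_(p, q)) :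
  (1 <= k)%N -> \rank M = 'C(k.+1, 2) ->
  exists (U : 'M[R]_(p, 'C(k.+1, 2))) (V : 'M[R]_('C(k.+1, 2), q)),
    M = U *m V /\
    runs (p * q) (system_program R) (input_state M)
      (fun s => st_out s = system_word (psd_system_of U V)).
Proof.
move=> k_gt0 rM; set N := (p * q)%N.
(* From [1 <= k <= d] and [d <= p], [d <= q] it follows that [p] and [q] are positive and that
   [p * q] bounds the turns of every loop. *)
have le_kd : (k <= 'C(k.+1, 2))%N by have := double_binS2 k; nia.
have le_dp : ('C(k.+1, 2) <= p)%N by rewrite -rM rank_leq_row.
have le_dq : ('C(k.+1, 2) <= q)%N by rewrite -rM rank_leq_col.
have p_gt0 : (0 < p)%N by lia.
have q_gt0 : (0 < q)%N by lia.
have le_pN : (p <= N)%N by rewrite leq_pmulr.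
have le_qN : (q <= N)%N by rewrite leq_pmull.
have input_regs : input_state M =
    State (nth 0%N [:: p; q; 0%N]) (st_cell (input_state M)) [::].
  congr State; apply/funext => y.
  by do 3?case: y => [|y] //; rewrite /= !nth_nil.
have [t [s [ex_s le_t [r [cell [es inv]]]]]] :=
  runs_factorize p_gt0 q_gt0 (peel_inv_input M).
have [eM er] := peel_inv_factor inv.
(* Replacing [r] by [d] gives the two factors the dimensions that the system requires. *)
rewrite er rM in eM es.
exists (\matrix_(i, l) cell 1%N (l * p + i)%N),
  (\matrix_(l, j) cell 2%N (l * q + j)%N); split=> //.
rewrite input_regs; apply: runs_seq; exists t, s; split=> //; rewrite es.
have le_kN : (k <= N)%N by lia.
apply/runs_seq/(runs_weaken (runs_find_size p q cell le_kN)) => _ <-.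
apply: runs_weaken (emits_system _ _ _ _ _ _) _; rewrite -/N; try lia.
by move=> _ <-.
Qed.

Theorem proposition4p5 (R : realType) :
  (forall (k p q : nat) (M : 'M[R]_(p, q))
      (U : 'M[R]_(p, 'C(k.+1, 2))) (V : 'M[R]_('C(k.+1, 2), q)),
    (1 <= k)%N ->
    nonneg_mx M ->
    \rank M = 'C(k.+1, 2) ->
    M = U *m V ->
    (is_psd_rank M k <->
     exists L K : 'M[R]_('C(k.+1, 2)),
       [/\ L *m K = 1%:M /\ K *m L = 1%:M,
           forall i : 'I_p, vec_psd (K *m (row i U)^T)^T
         & forall j : 'I_q, vec_psd ((col j V)^T *m L)]))
  /\
  (exists (prog : cmd R) (c e : nat),
    forall (k p q : nat) (M : 'M[R]_(p, q)),
      (1 <= k)%N ->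
      nonneg_mx M ->
      \rank M = 'C(k.+1, 2) ->
      exists (U : 'M[R]_(p, 'C(k.+1, 2))) (V : 'M[R]_('C(k.+1, 2), q))
             (t : nat) (s : state R),
        [/\ M = U *m V,
            exec prog (input_state M) t s,
            st_out s = system_word (psd_system_of U V)
          & (t <= c * (p * q) ^ e)%N]).
Proof.
split=> [k p q M U V k_gt0 _ rM eM|]; first exact: psd_rank_conditions.
(* The constants depend on the program alone, not on [k], [p], [q] or [M]. *)
exists (system_program R), (loop_cost 1 (system_program R)),
  (loop_depth (system_program R)) => k p q M k_gt0 _ rM.
have [U [V [eM [t [s [ex le_t out_s]]]]]] := runs_system_program k_gt0 rM.
exists U, V, t, s; split=> //; apply: leq_trans le_t _; apply: loop_cost_poly.
(* The polynomial bound needs [p * q] positive, which follows from [0 < d <= p] and [d <= q]. *)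
have := rank_leq_row M; have := rank_leq_col M; rewrite rM muln_gt0.
have := double_binS2 k; nia.
Qed.
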